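(* For each positive integer $k$, there exists a class of finite structures (indeed of digraphs) that is decided by a non-adaptive left $k$-query algorithm over $\mathbb{N}$ but not by any adaptive left $(k-1)$-query algorithm over $\mathbb{N}$.
   Context: Structures are finite relational structures with non-empty domain of a fixed signature $\tau$; $\mathsf{FIN}(\tau)$ is the class of all of them; classes are closed under isomorphism; $\hom(F,A)$ is the number of homomorphisms $F\to A$. A non-adaptive left $k$-query algorithm over $\mathbb{N}$ is a pair $((F_1,\dots,F_k),X)$ with $F_i\in\mathsf{FIN}(\tau)$, $X\subseteq\mathbb{N}^k$; it decides $\{D:(\hom(F_1,D),\dots,\hom(F_k,D))\in X\}$. For a set $\Sigma$, $\Sigma^{<\omega}$ is the set of finite strings over $\Sigma$; a subtree is a prefix-closed subset, a leaf an element with no proper extension in it. An adaptive left query algorithm over $\mathbb{N}$ is a function $G:\mathcal{T}\to\mathsf{FIN}(\tau)\cup\{\mathsf{YES},\mathsf{NO}\}$ with $\mathcal{T}\subseteq\mathbb{N}^{<\omega}$ a subtree and $G(\sigma)\in\{\mathsf{YES},\mathsf{NO}\}$ iff $\sigma$ is a leaf; its computation path on $A$ is the limit of $\sigma_0=\varepsilon$, $\sigma_{i+1}=\sigma_i$ if $G(\sigma_i)\in\{\mathsf{YES},\mathsf{NO}\}$, else $\sigma_{i+1}=\sigma_i\bullet\hom(G(\sigma_i),A)$; it must halt on all inputs and decides $\{A:G(\text{path of }A)=\mathsf{YES}\}$. It is an adaptive left $j$-query algorithm if all computation paths have length at most $j$. *)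

(* Defs.v *)
From mathcomp Require Import all_boot.

Set Implicit Arguments.
Unset Strict Implicit.
Unset Printing Implicit Defensive.

(** * Finite relational structures and homomorphism counts *)

Record signature : Type := Signature {
  symbol : finType;
  arity : symbol -> nat
}.

Record structure (tau : signature) : Type := Structure {
  dom : finType;
  dom_gt0 : 0 < #|dom|;
  interp : forall r : symbol tau, {set (arity r).-tuple dom}
}.

Definition is_hom (tau : signature) (A B : structure tau)
    (h : {ffun dom A -> dom B}) : bool :=
  [forall r : symbol tau, forall t : (arity r).-tuple (dom A),
     (t \in interp A r) ==> (map_tuple h t \in interp B r)].

Definition hom (tau : signature) (A B : structure tau) : nat :=
  #|[set h : {ffun dom A -> dom B} | is_hom h]|.

Definition isomorphic (tau : signature) (A B : structure tau) : Prop :=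
  exists f : dom A -> dom B, bijective f /\
    forall (r : symbol tau) (t : (arity r).-tuple (dom A)),
      (t \in interp A r) = (map_tuple f t \in interp B r).

Record struct_class (tau : signature) : Type := StructClass {
  in_class :> structure tau -> Prop;
  in_class_iso : forall A B : structure tau,
    isomorphic A B -> in_class A -> in_class B
}.

(** Digraphs may have loops. *)
Definition digraph_sig : signature :=
  @Signature unit (fun _ : unit => 2).

(** * Non-adaptive left query algorithms *)

Record nonadaptive_alg (tau : signature) (k : nat) : Type := NonadaptiveAlg {
  na_query : 'I_k -> structure tau;
  na_accept : k.-tuple nat -> Prop
}.

Definition nonadaptive_decides (tau : signature) (k : nat)
    (N : nonadaptive_alg tau k) (C : struct_class tau) : Prop :=
  forall D : structure tau,
    C D <-> na_accept N [tuple hom (na_query N i) D | i < k].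

(** * Adaptive left query algorithms *)

Inductive label (tau : signature) : Type :=
  | Query of structure tau
  | YES
  | NO.

Arguments YES {tau}.
Arguments NO {tau}.

Definition is_verdict (tau : signature) (l : label tau) : bool :=
  if l is Query _ then false else true.

(** A function from a subset of [seq nat] to labels is represented by a partial
    function, that subset being its domain of definition. *)
Definition tree (tau : signature) (G : seq nat -> option (label tau)) :
  pred (seq nat) := fun s => isSome (G s).

Definition is_leaf (T : pred (seq nat)) (s : seq nat) : Prop :=
  T s /\ forall u : seq nat, T u -> prefix s u -> u = s.

(** The string [sigma_i] of the computation on [A]. Outside the tree the
    computation gets stuck; [ad_halts] below excludes this. *)
Fixpoint comp_string (tau : signature) (G : seq nat -> option (label tau))
    (A : structure tau) (i : nat) : seq nat :=
  if i is j.+1 then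
    let s := comp_string G A j in
    if G s is Some (Query F) then rcons s (hom F A) else s
  else [::].

Definition comp_path (tau : signature) (G : seq nat -> option (label tau))
    (A : structure tau) (s : seq nat) : Prop :=
  exists m : nat, forall i : nat, m <= i -> comp_string G A i = s.

(** [ad_halts] forces the empty string to belong to the tree. *)
Record adaptive_alg (tau : signature) : Type := AdaptiveAlg {
  ad_fun :> seq nat -> option (label tau);
  ad_subtree : forall s u : seq nat,
    prefix s u -> tree ad_fun u -> tree ad_fun s;
  ad_verdict : forall (s : seq nat) (l : label tau),
    ad_fun s = Some l -> (is_verdict l <-> is_leaf (tree ad_fun) s);
  ad_halts : forall A : structure tau,
    exists s : seq nat, comp_path ad_fun A s /\ tree ad_fun s
}.

Definition adaptive_decides (tau : signature) (G : adaptive_alg tau)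
    (C : struct_class tau) : Prop :=
  forall A : structure tau,
    C A <-> exists s : seq nat, comp_path G A s /\ G s = Some YES.

Definition is_adaptive_query_alg (tau : signature) (j : nat)
    (G : adaptive_alg tau) : Prop :=
  forall (A : structure tau) (s : seq nat), comp_path G A s -> size s <= j.

(* Main.v *)
Require Import Defs.
From HB Require Import structures.
From mathcomp Require Import all_boot.
From mathcomp Require Import ssralg finalg zmodp.

(** Let A be a directed cycle of length the product of k distinct primes, and
    let B_i be the same number of vertices arranged in cycles whose length omits
    the i-th prime. If F maps to A, then hom(F, B_i) = hom(F, A) for all i: a
    homomorphism F -> A, read modulo the i-th prime, is a translation turning
    one set of homomorphisms into the other. If F does not map to A, then F maps
    to at most one B_i, since homomorphisms to B_i and B_j combine into one to A.
    Hence each query asked on input A distinguishes A from at most one B_i, and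
    k - 1 queries leave some B_i with the same computation as A. On the other
    hand, no B_i maps to A, so the class of digraphs admitting a homomorphism
    from some B_i contains every B_i but not A.

    These digraphs are realised uniformly, by the edges x -> x + u on a
    finite abelian group of k-tuples: s gives (copies of) A, and s with its
    i-th coordinate set to 0 gives B_i. *)

Set Implicit Arguments.
Unset Strict Implicit.
Unset Printing Implicit Defensive.

Import GRing.Theory.

Lemma hom_gt0P (tau : signature) (A B : structure tau) :
  reflect (exists h : {ffun dom A -> dom B}, is_hom h) (0 < hom A B).
Proof.
by apply: (iffP card_gt0P) => -[h hh]; exists h; move: hh; rewrite inE.
Qed.

Lemma hom_refl (tau : signature) (A : structure tau) : 0 < hom A A.
Proof.
apply/hom_gt0P; exists [ffun x => x].
apply/forallP => r; apply/forallP => t; apply/implyP.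
suff -> : map_tuple [ffun x => x] t = t by [].
by apply: eq_from_tnth => j; rewrite tnth_map ffunE.
Qed.

Lemma hom_iso_gt0 (tau : signature) (F A B : structure tau) :
  isomorphic A B -> 0 < hom F A -> 0 < hom F B.
Proof.
case=> f [_ fE] /hom_gt0P[h /forallP hh]; apply/hom_gt0P.
exists [ffun x => f (h x)].
apply/forallP => r; apply/forallP => t; apply/implyP => tF.
move: (implyP (forallP (hh r) t) tF); rewrite fE.
suff -> : map_tuple f (map_tuple h t) = map_tuple [ffun x => f (h x)] t by [].
by apply: eq_from_tnth => j; rewrite !tnth_map ffunE.
Qed.

(** * Runs of adaptive algorithms *)

Section Computation.

Variables (tau : signature) (G : seq nat -> option (label tau)).

Definition query_at (A : structure tau) (n : nat) : option (structure tau) :=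
  if G (comp_string G A n) is Some (Query F) then Some F else None.

Lemma comp_stringS A n : comp_string G A n.+1 =
  if query_at A n is Some F then rcons (comp_string G A n) (hom F A)
  else comp_string G A n.
Proof. by rewrite /query_at /=; case: (G _) => [[]|]. Qed.

(** A run that stalls never resumes, so a query at step [n] means that every earlier step appended
    an answer. *)
Lemma size_comp_string A n :
  query_at A n -> size (comp_string G A n) = n.
Proof.
elim: n => [//|n IHn]; rewrite comp_stringS.
case E: (query_at A n) => [F|]; last first.
  by rewrite /query_at comp_stringS E; move: E; rewrite /query_at => ->.
by rewrite size_rcons IHn // E.
Qed.

Lemma leq_size_comp_string A m n :
  m <= n -> size (comp_string G A m) <= size (comp_string G A n).
Proof.
move/subnK <-; elim: (n - m) => [//|d IHd].
apply: (leq_trans IHd); rewrite addSn comp_stringS.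
by case: (query_at _ _) => [F|//]; rewrite size_rcons.
Qed.

(** Agreement is needed only on the queries asked on [A]: as long as the answers coincide, the run
    on [B] asks those same queries. *)
Lemma comp_string_agree (A B : structure tau) :
  (forall n F, query_at A n = Some F -> hom F B = hom F A) ->
  forall n, comp_string G B n = comp_string G A n.
Proof.
move=> agree; elim=> [//|n IHn].
have qE : query_at B n = query_at A n by rewrite /query_at IHn.
rewrite !comp_stringS qE IHn.
by case E: (query_at A n) => [F|//]; rewrite (agree n F E).
Qed.

End Computation.

Lemma query_at_lt (tau : signature) (G : adaptive_alg tau) (j : nat) A n :
  is_adaptive_query_alg j G -> query_at G A n -> n < j.
Proof.
move=> Gj qn; have [s [[m ms] _]] := ad_halts G A.
apply: leq_trans (Gj A s (ex_intro _ m ms)).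
rewrite -(ms (maxn m n.+1)) ?leq_maxl //.
apply: leq_trans (leq_size_comp_string G A (leq_maxr _ _)).
rewrite comp_stringS; case E: (query_at G A n) qn => [F|//] _.
by rewrite size_rcons size_comp_string ?E.
Qed.

Lemma adaptive_undistinguished (tau : signature) (k : nat) (A : structure tau)
    (B : 'I_k -> structure tau) (G : adaptive_alg tau) (C : struct_class tau) :
    0 < k ->
    (forall F i j, hom F (B i) != hom F A -> hom F (B j) != hom F A -> i = j) ->
    is_adaptive_query_alg k.-1 G -> adaptive_decides G C ->
  exists i, C (B i) <-> C A.
Proof.
move=> k0 sep Gk dec.
pose split i n := if query_at G A n is Some F then hom F (B i) != hom F A
                  else false.
case: (boolP [forall i, exists n : 'I_k.-1, split i n]) => [/forallP all_split|].
  have [f fP] : exists f : 'I_k -> 'I_k.-1, forall i, split i (f i).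
    apply: (@fin_all_exists _ (fun=> 'I_k.-1) (fun i n => split i n)) => i.
    exact/existsP.
  (* Pigeonhole: by [sep] a single query distinguishes at most one [B i] from [A], so [f] would
     embed [k] indices into [k.-1] steps. *)
  have f_inj : injective f.
    move=> i j fij; move: (fP i) (fP j); rewrite fij /split.
    by case: (query_at _ _ _) => // F; apply: sep.
  by have := leq_card f f_inj; rewrite !card_ord leqNgt prednK ?leqnn.
rewrite negb_forall => /existsP[i]; rewrite negb_exists => /forallP no_split.
exists i.
have same : forall n, comp_string G (B i) n = comp_string G A n.
  apply: comp_string_agree => n F qE.
  have n_lt : n < k.-1 by rewrite (query_at_lt (A := A) Gk) ?qE.
  by have := no_split (Ordinal n_lt); rewrite /split qE negbK => /eqP.
have pathE s : comp_path G (B i) s <-> comp_path G A s.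
  by split=> -[m ms]; exists m => n /ms; rewrite same.
by split=> /dec[s [/pathE path_s Gs]]; apply/dec; exists s; split=> //.
Qed.

(** * Cayley digraphs of finite abelian groups with one generator *)

Section Cayley.

Local Open Scope ring_scope.

Variable V : finZmodType.

Lemma zmod_card_gt0 : (0 < #|V|)%N.
Proof. by apply/card_gt0P; exists 0. Qed.

Definition cayley (u : V) : structure digraph_sig :=
  @Structure digraph_sig V zmod_card_gt0
    (fun _ => [set t : 2.-tuple V | tnth t ord_max == tnth t ord0 + u]).

(** These are the homomorphisms into [cayley u], written as an equation that is additive in [g] and
    [u] jointly. *)
Definition potential (F : structure digraph_sig) (u : V)
    (g : {ffun dom F -> V}) : Prop :=
  forall t : 2.-tuple (dom F), t \in interp F tt ->
    g (tnth t ord_max) = g (tnth t ord0) + u.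

Lemma is_hom_cayleyP (F : structure digraph_sig) u (g : {ffun dom F -> V}) :
  reflect (potential u g) (@is_hom digraph_sig F (cayley u) g).
Proof.
apply: (iffP forallP) => [gh t tF|gp [] ].
  have := implyP (forallP (gh tt) t) tF.
  by rewrite inE !tnth_map => /eqP.
apply/forallP => t; apply/implyP => tF.
by rewrite inE !tnth_map; apply/eqP/gp.
Qed.

Lemma hom_cayley_gt0P (F : structure digraph_sig) u :
  reflect (exists g : {ffun dom F -> V}, potential u g) (0 < hom F (cayley u))%N.
Proof.
apply: (iffP (hom_gt0P _ _)) => -[g gh]; exists g; exact/is_hom_cayleyP.
Qed.

Lemma potentialB (F : structure digraph_sig) u w (g h : {ffun dom F -> V}) :
  potential u g -> potential w h -> potential (u - w) (g - h).
Proof.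
move=> gp hp t tF; rewrite !ffunE (gp _ tF) (hp _ tF).
by rewrite opprD addrACA.
Qed.

(** Subtracting [g] is a bijection between the two sets of homomorphisms, with inverse adding
    [g]. *)
Lemma hom_cayley_sub (F : structure digraph_sig) u w (g : {ffun dom F -> V}) :
  potential w g -> hom F (cayley (u - w)) = hom F (cayley u).
Proof.
move=> gp; rewrite /hom -[RHS](card_imset _ (addIr (- g))).
apply: eq_card => h; apply/idP/imsetP.
  rewrite inE => /is_hom_cayleyP hp.
  exists (h + g : {ffun dom F -> V}); last by rewrite addrK.
  rewrite inE; apply/is_hom_cayleyP => t tF.
  by rewrite !ffunE (hp _ tF) (gp _ tF) addrACA subrK.
case=> h' + ->; rewrite !inE => /is_hom_cayleyP hp.
by apply/is_hom_cayleyP/potentialB.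
Qed.

(* Following n edges from 0 in the first digraph leads back to 0. *)
Lemma hom_cayley_order u w n :
  (0 < hom (cayley u) (cayley w))%N -> u *+ n = 0 -> w *+ n = 0.
Proof.
case/hom_cayley_gt0P => g gp un0.
have gE m : g (u *+ m) = g 0 + w *+ m.
  elim: m => [|m IHm]; first by rewrite !mulr0n addr0.
  have := gp [tuple u *+ m; u *+ m.+1].
  by rewrite inE !(tnth_nth 0) /= mulrSr eqxx IHm mulrSr addrA; apply.
by apply: (addrI (g 0)); rewrite -gE un0 addr0.
Qed.

End Cayley.

(** * Deleting one coordinate of the generator *)

HB.instance Definition _ (I : finType) (Z : finZmodType) :=
  Finite.on {ffun I -> Z}.

Section Coordinates.

Local Open Scope ring_scope.

Variables (I : finType) (Z : finZmodType) (s : {ffun I -> Z}).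

Definition only (i : I) (v : {ffun I -> Z}) : {ffun I -> Z} :=
  [ffun l => if l == i then v l else 0].

Let drop_coord (i : I) := cayley (s - only i s : {ffun I -> Z}).

(** [only i] is additive; the resulting potential is the translation that deletes coordinate [i]
    from [s]. *)
Lemma potential_only (F : structure digraph_sig) i
    (g : {ffun dom F -> {ffun I -> Z}}) :
  potential s g -> potential (only i s) [ffun x => only i (g x)].
Proof.
move=> gp t tF; rewrite !ffunE (gp _ tF); apply/ffunP => l.
by rewrite !ffunE; case: eqP; rewrite ?addr0.
Qed.

Lemma hom_drop_coord (F : structure digraph_sig) i :
  (0 < hom F (cayley s))%N -> hom F (drop_coord i) = hom F (cayley s).
Proof.
by case/hom_cayley_gt0P => g /(potential_only i); apply: hom_cayley_sub.
Qed.

(* A map into the digraph without coordinate i provides every coordinate but the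
   i-th, and a map into the one without coordinate j provides the i-th. *)
Lemma hom_glue (F : structure digraph_sig) i j : i != j ->
  (0 < hom F (drop_coord i))%N -> (0 < hom F (drop_coord j))%N ->
  (0 < hom F (cayley s))%N.
Proof.
move=> neq_ij /hom_cayley_gt0P[g gp] /hom_cayley_gt0P[h hp].
apply/hom_cayley_gt0P.
exists [ffun x => [ffun l => if l == i then h x l else g x l]] => t tF.
rewrite !ffunE (gp _ tF) (hp _ tF); apply/ffunP => l; rewrite !ffunE.
case: eqP => [->|_]; last by rewrite subr0.
by rewrite (negPf neq_ij) subr0.
Qed.

Lemma drop_coord_separated (F : structure digraph_sig) i j :
  hom F (drop_coord i) != hom F (cayley s) ->
  hom F (drop_coord j) != hom F (cayley s) -> i = j.
Proof.
move=> ni nj; case: (posnP (hom F (cayley s))) => [F0|F_gt0]; last first.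
  by rewrite (hom_drop_coord i F_gt0) eqxx in ni.
apply/eqP; apply: contraT => neq_ij.
rewrite F0 -!lt0n in ni nj.
by have := hom_glue neq_ij ni nj; rewrite F0.
Qed.

End Coordinates.

(** * A generator whose coordinates have distinct prime orders *)

Lemma distinct_primes : exists p : nat -> nat, injective p /\ forall n, prime (p n).
Proof.
pose p n := iter n (fun m => s2val (prime_above m)) 2.
have p_lt n : p n < p n.+1 by rewrite /p /=; case: (prime_above _).
exists p; split; last by case=> [//|n]; rewrite /p /=; case: (prime_above _).
move=> m n /eqP; apply: contraTeq; rewrite neq_ltn => /orP[] lt_mn.
  by rewrite ltn_eqF //; apply: (homo_ltn ltn_trans p_lt).
by rewrite gtn_eqF //; apply: (homo_ltn ltn_trans p_lt).
Qed.

Lemma independent_orders (k : nat) : exists (M : nat) (s : {ffun 'I_k -> 'Z_M}),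
  forall i, exists n : nat,
    (s i *+ n != 0 /\ forall j, j != i -> s j *+ n = 0)%R.
Proof.
have [p [p_inj p_prime]] := distinct_primes.
pose c (i : 'I_k) := \prod_(j < k | j != i) p j.
pose M := \prod_(j < k) p j.
have ME (i : 'I_k) : M = p i * c i by rewrite /M (bigD1 i).
have c_gt0 (i : 'I_k) : 0 < c i by apply: prodn_gt0 => j; apply: prime_gt0.
(* An index is required: for [k = 0] the product [M] is 1, and ['Z_1] is by convention the group of
   order 2. *)
have M_gt1 (i : 'I_k) : 1 < M.
  by rewrite (ME i) (leq_trans (prime_gt1 (p_prime i))) // leq_pmulr.
have natr_eq0 (i : 'I_k) m : (m%:R == 0 :> 'Z_M)%R = (M %| m).
  by rewrite -val_eqE /= val_Zp_nat ?(M_gt1 i).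
(* [c j], that is [M] divided by [p j], has order [p j] modulo [M]. The multiplier [c i] is
   divisible by every chosen prime except [p i]. *)
exists M, [ffun j => (c j)%:R%R] => i; exists (c i); split.
  rewrite ffunE -mulrnA (natr_eq0 i); apply/negP.
  rewrite {1}(ME i) dvdn_pmul2r //.
  rewrite Euclid_dvd_prod // big_orE => /existsP[j /andP[neq_ji]].
  rewrite dvdn_prime2 // => /eqP/p_inj/val_inj ij.
  by rewrite ij eqxx in neq_ji.
move=> j neq_ji; apply/eqP; rewrite ffunE -mulrnA (natr_eq0 i) (ME j) mulnC.
by rewrite dvdn_pmul2l // /c (bigD1 j) //= dvdn_mulr.
Qed.

Theorem theorem17 (k : nat) (hk : 0 < k) :
  exists C : struct_class digraph_sig,
    (exists N : nonadaptive_alg digraph_sig k, nonadaptive_decides N C) /\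
    ~ (exists G : adaptive_alg digraph_sig,
         is_adaptive_query_alg k.-1 G /\ adaptive_decides G C).
Proof.
have [M [s s_indep]] := independent_orders k.
pose A := cayley s; pose B i := cayley (s - only i s)%R.
have hom_BA i : hom (B i) A = 0.
  apply/eqP; rewrite -leqn0 leqNgt; apply/negP => BA.
  have [n [sin sjn]] := s_indep i.
  (* [n] annihilates every coordinate of [s] but the [i]-th, hence the generator of [B i]; a map
     from [B i] to [A] would make it annihilate [s] too. *)
  have : (s *+ n = 0)%R.
    apply: hom_cayley_order BA _; apply/ffunP => l.
    rewrite ffunMnE !ffunE; case: eqP => [->|/eqP/sjn sl].
      by rewrite subrr mul0rn.
    by rewrite subr0.
  by move/ffunP/(_ i); rewrite ffunMnE ffunE; apply/eqP.
pose in_C (D : structure digraph_sig) := exists i, 0 < hom (B i) D.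
have in_C_iso D D' : isomorphic D D' -> in_C D -> in_C D'.
  by move=> isoD [i BD]; exists i; apply: hom_iso_gt0 isoD BD.
exists (StructClass in_C_iso); split.
  exists (NonadaptiveAlg B (fun t => exists i, 0 < tnth t i)) => D /=.
  by split=> -[i BD]; exists i; rewrite tnth_mktuple in BD *.
case=> G [Gk dec].
have [i [CB _]] := adaptive_undistinguished hk (@drop_coord_separated _ _ s) Gk dec.
(* The identity puts [B i] in the class, and the indistinguishable [A] would follow. *)
have [j] : in_C A by apply: CB; exists i; apply: hom_refl.
by rewrite hom_BA.
Qed.
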